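(* Let $\rho=\rho_{A_1A_2\cdots A_{\mathcal N}}$ be a state on $H_{A_1}\otimes\cdots\otimes H_{A_{\mathcal N}}$ with $\dim H_{A_i}=d_{A_i}$, and for each $i$ let $\{E^{A_i}_{\alpha,k}\}$ be an informationally complete $(N_{A_i},M_{A_i})$ POVM on $H_{A_i}$ with parameter $x_{A_i}$. Write $K_{A_i}=\frac{(d_{A_i}-1)(d_{A_i}^2+M_{A_i}^2x_{A_i})}{d_{A_i}M_{A_i}(M_{A_i}-1)}$. Let $\mu,\nu\in\mathbb{R}$ and $l$ a positive integer. If $\rho$ is fully separable, then for every $q\in\{1,\dots,\mathcal N\}$, $$\left\|\mathscr{M}^l_{\mu,\nu}(\rho_{A_q|\overline{A_q}})\right\|_{\mathrm{tr}}\le\sqrt{\left(l\mu^2+K_{A_q}\right)\left(l\nu^2+\prod_{i\ne q}K_{A_i}\right)}.$$ Hence a state violating this inequality for some $q$ is entangled (not fully separable).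
   Context: An $(N,M)$ POVM on $\mathbb{C}^d$ ($M\ge2$) consists of $N$ POVMs $\{E_{\alpha,k}\mid k=1,\dots,M\}$ satisfying $\mathrm{tr}(E_{\alpha,k})=d/M$, $\mathrm{tr}(E_{\alpha,k}^2)=x$, $\mathrm{tr}(E_{\alpha,k}E_{\alpha,l})=\frac{d-Mx}{M(M-1)}$ ($l\ne k$), $\mathrm{tr}(E_{\alpha,k}E_{\beta,l})=d/M^2$ ($\beta\ne\alpha$), where $\frac{d}{M^2}<x\le\min\{\frac{d^2}{M^2},\frac dM\}$; informationally complete means $N(M-1)=d^2-1$. Fully separable: a convex combination of tensor products $\rho^{A_1}_i\otimes\cdots\otimes\rho^{A_{\mathcal N}}_i$ of local density matrices. For fixed $q$, let $\overline{A_q}$ denote all parties other than $A_q$; $\rho_{A_q}$ and $\rho_{\overline{A_q}}$ are the reduced states. $\tau_{A_q}$ is the column vector with entries $\mathrm{tr}(E^{A_q}_{\alpha,k}\rho_{A_q})$; $\sigma_{\overline{A_q}}$ is the column vector with entries $\mathrm{tr}[(\bigotimes_{i\ne q}E^{A_i}_{\alpha_i,k_i})\rho_{\overline{A_q}}]$ indexed by the tuple $((\alpha_i,k_i))_{i\ne q}$; $\mathcal{P}(\rho_{A_q|\overline{A_q}})$ is the matrix with entries $\mathrm{tr}[(E^{A_1}_{\alpha_1,k_1}\otimes\cdots\otimes E^{A_{\mathcal N}}_{\alpha_{\mathcal N},k_{\mathcal N}})\rho]$ with row index $(\alpha_q,k_q)$ and column index $((\alpha_i,k_i))_{i\ne q}$,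 all in lexicographic order. Then $$\mathscr{M}^l_{\mu,\nu}(\rho_{A_q|\overline{A_q}})=\begin{pmatrix}\mu\nu J_{l\times l}&\mu\,\omega_l(\sigma_{\overline{A_q}})^T\\ \nu\,\omega_l(\tau_{A_q})&\mathcal{P}(\rho_{A_q|\overline{A_q}})\end{pmatrix},$$ where $J_{l\times l}$ is the $l\times l$ all-ones matrix and $\omega_l(V)=(V,\dots,V)$ has $l$ columns equal to $V$. $\|G\|_{\mathrm{tr}}=\mathrm{tr}\sqrt{G^\dagger G}$. *)

(* Defs.v *)
(* Complex scalars: an arbitrary numClosedFieldType C
   (e.g. complex R for R real closed); conjugation is ^*.  *)
From HB Require Import structures.
From mathcomp Require Import all_boot all_order all_algebra.
From Stdlib Require Import ClassicalEpsilon.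
Set Implicit Arguments. Unset Strict Implicit. Unset Printing Implicit Defensive.
Import Order.TTheory GRing.Theory Num.Theory.
Local Open Scope ring_scope.

Definition fmx (C : numClosedFieldType) (I J : finType) := I -> J -> C.

Section Fmx.
Variable C : numClosedFieldType.

Definition mulf (I J K : finType) (A : fmx C I J) (B : fmx C J K) : fmx C I K :=
  fun i k => \sum_(j : J) A i j * B j k.

Definition adjf (I J : finType) (A : fmx C I J) : fmx C J I :=
  fun j i => (A i j)^*.

Definition trf (I : finType) (A : fmx C I I) : C := \sum_(i : I) A i i.

Definition idf (I : finType) : fmx C I I := fun i j => (i == j)%:R.

Definition hermitianf (I : finType) (A : fmx C I I) : Prop :=
  forall i j, A j i = (A i j)^*.

Definition psdf (I : finType) (A : fmx C I I) : Prop :=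
  hermitianf A /\
  forall v : I -> C, 0 <= \sum_(i : I) \sum_(j : I) (v i)^* * A i j * v j.

Definition densityf (I : finType) (rho : fmx C I I) : Prop :=
  psdf rho /\ trf rho = 1.

Definition psd_sqrt (J : finType) (A : fmx C J J) : fmx C J J :=
  epsilon (inhabits (fun _ _ => 0 : C))
          (fun S : fmx C J J => psdf S /\ mulf S S = A).

Definition trnorm (I J : finType) (G : fmx C I J) : C :=
  trf (psd_sqrt (mulf (adjf G) G)).

Definition ic_povm (d N M : nat) (x : C)
    (E : 'I_N -> 'I_M -> fmx C 'I_d 'I_d) : Prop :=
  [/\ (2 <= M)%N /\ (N * (M - 1) = d ^ 2 - 1)%N,
      x \is Num.real,
      [/\ d%:R / (M%:R ^+ 2) < x, x <= (d%:R ^+ 2) / (M%:R ^+ 2) & x <= d%:R / M%:R],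
      ((forall a k, psdf (E a k)) /\ (forall a i j, \sum_(k < M) E a k i j = idf i j)) &
      [/\ forall a k, trf (E a k) = d%:R / M%:R,
          forall a k, trf (mulf (E a k) (E a k)) = x,
          forall a k l, k != l ->
            trf (mulf (E a k) (E a l)) = (d%:R - M%:R * x) / (M%:R * (M%:R - 1)) &
          forall a b k l, a != b ->
            trf (mulf (E a k) (E b l)) = d%:R / (M%:R ^+ 2)]].

Definition Kconst (d M : nat) (x : C) : C :=
  ((d%:R - 1) * (d%:R ^+ 2 + M%:R ^+ 2 * x)) / (d%:R * M%:R * (M%:R - 1)).

Definition gidx (n : nat) (d : 'I_n -> nat) : finType :=
  {dffun forall i : 'I_n, 'I_(d i)}.

Definition others (n : nat) (q : 'I_n) : finType := {j : 'I_n | j != q}.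

Definition cidx (n : nat) (d : 'I_n -> nat) (q : 'I_n) : finType :=
  {dffun forall j : others q, 'I_(d (val j))}.

Definition restr (n : nat) (d : 'I_n -> nat) (q : 'I_n) (x : gidx d) : cidx d q :=
  [ffun j : others q => x (val j)].

Definition tensf (I : finType) (D : I -> finType) (A : forall i, fmx C (D i) (D i))
  : fmx C {dffun forall i, D i} {dffun forall i, D i} :=
  fun x y => \prod_(i : I) A i (x i) (y i).

Definition fully_separable (n : nat) (d : 'I_n -> nat) (rho : fmx C (gidx d) (gidx d))
  : Prop :=
  exists (K : nat) (p : 'I_K -> C)
         (sg : 'I_K -> forall i : 'I_n, fmx C 'I_(d i) 'I_(d i)),
    [/\ forall m, 0 <= p m, \sum_(m < K) p m = 1,
        forall m i, densityf (sg m i) &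
        forall x y, rho x y = \sum_(m < K) p m * tensf (sg m) x y].

Definition red_q (n : nat) (d : 'I_n -> nat) (q : 'I_n) (rho : fmx C (gidx d) (gidx d))
  : fmx C 'I_(d q) 'I_(d q) :=
  fun a b => \sum_(x : gidx d) \sum_(y : gidx d)
    ((x q == a) && (y q == b) && (restr q x == restr q y))%:R * rho x y.

Definition red_bar (n : nat) (d : 'I_n -> nat) (q : 'I_n) (rho : fmx C (gidx d) (gidx d))
  : fmx C (cidx d q) (cidx d q) :=
  fun u v => \sum_(x : gidx d) \sum_(y : gidx d)
    ((restr q x == u) && (restr q y == v) && (x q == y q))%:R * rho x y.

Arguments red_q {n d} q rho _ _.
Arguments red_bar {n d} q rho _ _.
Arguments restr {n d} q x.

Section Corr.
Variables (n : nat) (d N M : 'I_n -> nat).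
Variable E : forall i : 'I_n, 'I_(N i) -> 'I_(M i) -> fmx C 'I_(d i) 'I_(d i).
Variables (q : 'I_n) (rho : fmx C (gidx d) (gidx d)).

Definition rowidx : finType := ('I_(N q) * 'I_(M q))%type.
Definition colidx : finType :=
  {dffun forall j : others q, ('I_(N (val j)) * 'I_(M (val j)))%type}.

Definition Ebar (c : colidx) : fmx C (cidx d q) (cidx d q) :=
  tensf (fun j : others q => E (c j).1 (c j).2).

Definition tau_vec (r : rowidx) : C := trf (mulf (E r.1 r.2) (red_q q rho)).
Definition sigma_vec (c : colidx) : C := trf (mulf (Ebar c) (red_bar q rho)).

(* P entry: tr[(E^{A_q}_{r} (x) Ebar_c) rho], with the global index x
   identified with the pair (x q, restr x). *)
Definition Pmat : fmx C rowidx colidx :=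
  fun r c => \sum_(x : gidx d) \sum_(y : gidx d)
    E r.1 r.2 (x q) (y q) * Ebar c (restr q x) (restr q y) * rho y x.

Definition Mmat (l : nat) (mu nu : C) : fmx C ('I_l + rowidx)%type ('I_l + colidx)%type :=
  fun i j => match i, j with
             | inl _, inl _ => mu * nu
             | inl _, inr c => mu * sigma_vec c
             | inr r, inl _ => nu * tau_vec r
             | inr r, inr c => Pmat r c
             end.
End Corr.
End Fmx.

Arguments Mmat {C n d N M} E q rho l mu nu _ _.

(* Main.v *)
Require Import Defs.
From mathcomp Require Import all_boot all_order all_algebra.
From mathcomp Require Import ring.
From Stdlib Require Import ClassicalEpsilon FunctionalExtensionality.
Set Implicit Arguments.
Unset Strict Implicit.
Unset Printing Implicit Defensive.

Import Order.TTheory GRing.Theory Num.Theory.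
(* [fraction] also exports a [mulf]. *)
Import Defs.
Local Open Scope ring_scope.

(* For a fully separable state the correlation matrix is a convex combination
   of rank-one matrices [a b^T], where [a] and [b] extend, by [l] copies of
   [mu] and [nu], the measurement probabilities of the local states on [A_q]
   and on the other parties.  The polar decomposition writes the trace norm as
   a pairing with orthonormal families, so Bessel and Cauchy-Schwarz bound it
   by the largest [|a| |b|].  Local probabilities have square sum at most [K]:
   the traceless parts of the effects form a frame with bound
   [lam = (M^2 x - d) / (M (M - 1))], to which the traceless part of a density
   matrix, of squared norm at most [1 - 1/d], is projected. *)

(** * Sums over dependent functions, and splitting off the party [q] *)

Lemma prod_sum_dffun (R : comPzSemiRingType) (I : finType) (T : I -> finType)
    (P : forall i, T i -> R) :
  \prod_i \sum_(t : T i) P i t =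
  \sum_(f : {dffun forall i, T i}) \prod_i P i (f i).
Proof.
rewrite (reindex (@dffun_of_fprod I T)); last exact/onW_bij/dffun_of_fprod_bij.
transitivity (\sum_(t : fprod T) \prod_(i in I) [ffun t => P i t] (t i)).
  (* Tagging puts all the index types into one, where ordinary distributivity applies. The default
     [0] of [untag] is never reached: only values with tag [i] occur. *)
  rewrite big_fprod -(bigA_distr_big_dep _ (fun i j => untag 0 [ffun t => P i t] j)); apply: eq_bigr => i _.
  by rewrite -(big_tag (fun i => [ffun t => P i t])); apply: eq_bigr => t _; rewrite ffunE.
by apply: eq_bigr => t _; apply: eq_bigr => i _; rewrite !ffunE.
Qed.

Section SplitParty.
Variables (n : nat) (d : 'I_n -> nat) (q : 'I_n).

Lemma big_others (R : Type) (idx : R) (op : Monoid.com_law idx)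
    (F : 'I_n -> R) :
  \big[op/idx]_(j : others q) F (val j) = \big[op/idx]_(j < n | j != q) F j.
Proof. by rewrite -(big_sub [pred j | j != q]). Qed.

Lemma card_dffun (I : finType) (T : I -> finType) :
  #|{dffun forall i, T i}| = (\prod_i #|T i|)%N.
Proof.
by rewrite card_dep_ffun foldrE big_image.
Qed.

(** Injectivity and equal cardinalities suffice, so no dependent function has to be glued back
    together from its value at [q] and its restriction. *)
Lemma split_bij :
  bijective (fun x : gidx d => (x q, restr q x) : 'I_(d q) * cidx d q).
Proof.
apply: inj_card_bij.
  move=> x y [exy /ffunP exy']; apply/ffunP => i.
  have [->//|ne] := eqVneq i q.
  by have := exy' (exist _ i ne); rewrite !ffunE.
rewrite card_prod !card_dffun (bigD1 q) //= leq_mul2l; apply/orP; right.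
by rewrite (big_others _ (fun j => #|'I_(d j)|)).
Qed.

Lemma sum_split (V : nmodType) (F : 'I_(d q) -> cidx d q -> V) :
  \sum_(x : gidx d) F (x q) (restr q x) = \sum_a \sum_u F a u.
Proof.
rewrite pair_big /= (reindex (fun x : gidx d => (x q, restr q x))) //=.
exact/onW_bij/split_bij.
Qed.
End SplitParty.

(** * Spectral decomposition *)

Section Spectral.
Variable C : numClosedFieldType.

Definition dotf (I : finType) (u v : I -> C) : C := \sum_i (u i)^* * v i.

Definition orthonormalf (K I : finType) (v : K -> I -> C) : Prop :=
  forall k l, dotf (v k) (v l) = (k == l)%:R.

Lemma dotf_conj (I : finType) (u v : I -> C) : (dotf u v)^* = dotf v u.
Proof.
by rewrite rmorph_sum; apply: eq_bigr => i _; rewrite rmorphM /= conjCK mulrC.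
Qed.

Lemma dotfE (I : finType) (u : I -> C) : dotf u u = \sum_i `|u i| ^+ 2.
Proof. by apply: eq_bigr => i _; rewrite normCK mulrC. Qed.

Lemma dotf_ge0 (I : finType) (u : I -> C) : 0 <= dotf u u.
Proof. by rewrite dotfE sumr_ge0 // => i _; rewrite exprn_ge0. Qed.

Lemma dotf_sumr (K I : finType) (u : I -> C) (c : K -> C) (v : K -> I -> C) :
  dotf u (fun i => \sum_k c k * v k i) = \sum_k c k * dotf u (v k).
Proof.
rewrite /dotf; under eq_bigr do rewrite mulr_sumr.
rewrite exchange_big; apply: eq_bigr => k _; rewrite mulr_sumr.
by apply: eq_bigr => i _; rewrite mulrCA.
Qed.

Lemma dotf_orthonormal (K I : finType) (v : K -> I -> C) (c : K -> C) k :
  orthonormalf v -> dotf (v k) (fun i => \sum_l c l * v l i) = c k.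
Proof.
move=> ov; rewrite dotf_sumr (bigD1 k) //= ov eqxx mulr1 big1 ?addr0 // => l lk.
by rewrite ov eq_sym (negPf lk) mulr0.
Qed.

(** With [b] the projection of [a] to the span of [v], the products of [a] with [b], [b] with [a]
    and [b] with [b] all equal the left-hand side; expand the squared norm of [a - b]. *)
Lemma bessel (K I : finType) (v : K -> I -> C) (a : I -> C) :
  orthonormalf v -> \sum_k `|dotf (v k) a| ^+ 2 <= \sum_i `|a i| ^+ 2.
Proof.
move=> ov; pose c k := dotf (v k) a.
pose b i := \sum_k c k * v k i.
have ab : dotf a b = \sum_k `|c k| ^+ 2.
  rewrite dotf_sumr; apply: eq_bigr => k _.
  by rewrite normCK -(dotf_conj (v k) a).
have ba : dotf b a = \sum_k `|c k| ^+ 2.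
  rewrite -dotf_conj ab rmorph_sum; apply: eq_bigr => k _.
  by rewrite rmorphXn /= geC0_conj.
have bb : dotf b b = \sum_k `|c k| ^+ 2.
  rewrite dotf_sumr; apply: eq_bigr => k _.
  by rewrite normCK -dotf_conj dotf_orthonormal.
have: 0 <= dotf (fun i => a i - b i) (fun i => a i - b i) by exact: dotf_ge0.
suff -> : dotf (fun i => a i - b i) (fun i => a i - b i) =
    dotf a a - dotf a b - dotf b a + dotf b b.
  by rewrite ab ba bb subrK dotfE subr_ge0.
rewrite /dotf -!sumrB -big_split; apply: eq_bigr => i _ /=.
by rewrite rmorphB; ring.
Qed.

(** Lagrange's identity: twice the defect of Cauchy-Schwarz is a sum of squares over ordered pairs
    [(k, l)]. *)
Lemma cauchy_schwarz_sum (K : finType) (a b : K -> C) (A B : C) :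
  \sum_k `|a k| ^+ 2 <= A -> \sum_k `|b k| ^+ 2 <= B ->
  \sum_k `|a k| * `|b k| <= sqrtC (A * B).
Proof.
move=> leA leB.
have sum_ge0 (f : K -> C) : 0 <= \sum_k `|f k| ^+ 2.
  by apply: sumr_ge0 => k _; rewrite exprn_ge0.
have s0 : 0 <= \sum_k `|a k| * `|b k|.
  by apply: sumr_ge0 => k _; rewrite mulr_ge0.
rewrite -(sqrCK s0) ler_sqrtC ?qualifE /= ?exprn_ge0 ?mulr_ge0 ?(le_trans _ leA)
  ?(le_trans _ leB) //.
apply: le_trans (ler_pM _ _ leA leB) => //.
rewrite -subr_ge0 -(@pmulrn_lge0 _ _ 2) //.
suff -> : ((\sum_k `|a k| ^+ 2) * (\sum_k `|b k| ^+ 2) -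
    (\sum_k `|a k| * `|b k|) ^+ 2) *+ 2 =
    \sum_k \sum_l (`|a k| * `|b l| - `|a l| * `|b k|) ^+ 2.
  apply: sumr_ge0 => k _; apply: sumr_ge0 => l _.
  by rewrite real_exprn_even_ge0 // rpredB // rpredM // normr_real.
  pose f k l := `|a k| ^+ 2 * `|b l| ^+ 2.
  pose g k l := (`|a k| * `|b k|) * (`|a l| * `|b l|).
  have fE : \sum_k \sum_l f k l = (\sum_k `|a k| ^+ 2) * (\sum_k `|b k| ^+ 2).
    by rewrite mulr_suml; apply: eq_bigr => k _; rewrite mulr_sumr.
  have fE' : \sum_k \sum_l f l k = (\sum_k `|a k| ^+ 2) * (\sum_k `|b k| ^+ 2).
    by rewrite exchange_big.
  have gE : \sum_k \sum_l g k l = (\sum_k `|a k| * `|b k|) ^+ 2.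
    by rewrite expr2 mulr_suml; apply: eq_bigr => k _; rewrite mulr_sumr.
  rewrite mulr2n -gE -{1}fE -fE' addrACA -opprD -!big_split -sumrB.
  apply: eq_bigr => k _ /=.
  rewrite -!big_split -sumrB; apply: eq_bigr => l _ /=.
  by rewrite /f /g; ring.
Qed.

(** Enumerating [I] turns [A] into a hermitian matrix, diagonalized by a unitary [P]. The
    eigenvectors are the conjugated rows of [P]. *)
Lemma psdf_spectral (I : finType) (A : fmx C I I) : psdf A ->
  exists (s : 'I_#|I| -> C) (v : 'I_#|I| -> I -> C),
    [/\ forall k, 0 <= s k, orthonormalf v &
        forall i j, A i j = \sum_k s k * (v k i * (v k j)^*)].
Proof.
move=> [hA posA].
pose B : 'M[C]_#|I| := \matrix_(i, j) A (enum_val i) (enum_val j).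
have hB : B \is hermsymmx.
  apply/is_hermitianmxP; rewrite expr0 scale1r; apply/matrixP => i j.
  by rewrite !mxE hA.
have /hermitian_normalmx /orthomx_spectralP BE := hB.
pose P := spectralmx B; pose s (k : 'I_#|I|) : C := spectral_diag B 0 k.
have uP : P \is unitarymx by exact: spectral_unitarymx.
rewrite invmx_unitary // -/P in BE.
pose v k (i : I) := (P k (enum_rank i))^*.
have ov : orthonormalf v.
  move=> k l; move/unitarymxP/matrixP/(_ k l): uP; rewrite !mxE => <-.
  rewrite /dotf (reindex _ (onW_bij _ (@enum_val_bij I))) /=.
  by apply: eq_bigr => i _; rewrite /v !mxE conjCK enum_valK.
have AE i j : A i j = \sum_k s k * (v k i * (v k j)^*).
  have -> : A i j = B (enum_rank i) (enum_rank j) by rewrite mxE !enum_rankK.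
  rewrite BE !mxE; apply: eq_bigr => k _.
  by rewrite mul_mx_diag !mxE /v conjCK mulrAC mulrC.
exists s, v; split=> // k.
(* The quadratic form at a unit eigenvector is its eigenvalue. *)
suff <- : \sum_i \sum_j (v k i)^* * A i j * v k j = s k by exact: posA.
transitivity (dotf (v k) (fun i => \sum_l (s l * dotf (v l) (v k)) * v l i)).
  apply: eq_bigr => i _; rewrite mulr_sumr.
  under eq_bigr => j _ do rewrite AE mulr_sumr mulr_suml.
  rewrite exchange_big; apply: eq_bigr => l _ /=.
  rewrite mulr_sumr mulr_suml mulr_sumr.
  by apply: eq_bigr => j _; ring.
by rewrite dotf_orthonormal // ov eqxx mulr1.
Qed.

Lemma trf_spectral (K I : finType) (s : K -> C) (v : K -> I -> C)
    (A : fmx C I I) : orthonormalf v ->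
  (forall i j, A i j = \sum_k s k * (v k i * (v k j)^*)) -> trf A = \sum_k s k.
Proof.
move=> ov AE; rewrite /trf; under eq_bigr do rewrite AE.
rewrite exchange_big; apply: eq_bigr => k _ /=.
rewrite -mulr_sumr; have := ov k k; rewrite eqxx /dotf => ovk.
by under eq_bigr do rewrite mulrC; rewrite ovk mulr1.
Qed.

Lemma mulf_spectral (K I : finType) (s t : K -> C) (v : K -> I -> C)
    (A B : fmx C I I) : orthonormalf v ->
  (forall i j, A i j = \sum_k s k * (v k i * (v k j)^*)) ->
  (forall i j, B i j = \sum_k t k * (v k i * (v k j)^*)) ->
  forall i j, mulf A B i j = \sum_k (s k * t k) * (v k i * (v k j)^*).
Proof.
move=> ov AE BE i j; rewrite /mulf.
under eq_bigr => m _ do rewrite AE mulr_suml.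
rewrite exchange_big; apply: eq_bigr => k _ /=.
transitivity (s k * v k i * dotf (v k) (fun m => \sum_l (t l * (v l j)^*) * v l m)).
  rewrite /dotf mulr_sumr; apply: eq_bigr => m _; rewrite BE !mulrA.
  by rewrite !mulr_sumr; apply: eq_bigr => l _; ring.
by rewrite dotf_orthonormal //; ring.
Qed.

End Spectral.

(** * Trace norm *)

Section TraceNorm.
Variable C : numClosedFieldType.

Definition apply_mx (I J : finType) (G : fmx C I J) (w : J -> C) : I -> C :=
  fun i => \sum_j G i j * w j.

Lemma dotf_gram (I J : finType) (G : fmx C I J) (w z : J -> C) :
  dotf (apply_mx G w) (apply_mx G z) =
  \sum_i \sum_j (w i)^* * mulf (adjf G) G i j * z j.
Proof.
transitivity (\sum_r \sum_i \sum_j (w i)^* * ((G r i)^* * G r j) * z j).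
  apply: eq_bigr => r _; rewrite rmorph_sum /= mulr_suml.
  apply: eq_bigr => i _; rewrite mulr_sumr; apply: eq_bigr => j _.
  by rewrite rmorphM /=; ring.
rewrite exchange_big; apply: eq_bigr => i _; rewrite exchange_big.
by apply: eq_bigr => j _; rewrite /mulf mulr_sumr mulr_suml.
Qed.

Lemma psdf_gram (I J : finType) (G : fmx C I J) : psdf (mulf (adjf G) G).
Proof.
split=> [i j|w]; last by rewrite -dotf_gram dotf_ge0.
rewrite /mulf rmorph_sum; apply: eq_bigr => r _.
by rewrite rmorphM /adjf /= conjCK mulrC.
Qed.

Lemma psdf_of_spectral (K I : finType) (s : K -> C) (v : K -> I -> C) :
  (forall k, 0 <= s k) ->
  psdf (fun i j => \sum_k s k * (v k i * (v k j)^*)).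
Proof.
move=> s0; split=> [i j|w].
  rewrite rmorph_sum; apply: eq_bigr => k _.
  by rewrite !rmorphM /= conjCK (geC0_conj (s0 k)) [v k j * _]mulrC.
rewrite (_ : \sum_i _ = \sum_k s k * `|dotf (v k) w| ^+ 2).
  by apply: sumr_ge0 => k _; rewrite mulr_ge0 // exprn_ge0.
under eq_bigr => i _ do
  (under eq_bigr => j _ do rewrite mulr_sumr mulr_suml; rewrite exchange_big).
rewrite exchange_big; apply: eq_bigr => k _ /=.
rewrite normCK dotf_conj (_ : s k * _ = dotf w (v k) * (s k * dotf (v k) w)).
  rewrite mulr_suml; apply: eq_bigr => i _; rewrite !mulr_sumr.
  by apply: eq_bigr => j _; ring.
by ring.
Qed.

(** The root is picked by [epsilon], so its specification only asks that some positive root exists: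
    take square roots of the eigenvalues. *)
Lemma psd_sqrtP (J : finType) (A : fmx C J J) : psdf A ->
  psdf (psd_sqrt A) /\ mulf (psd_sqrt A) (psd_sqrt A) = A.
Proof.
move=> psdA; apply: (epsilon_spec (inhabits (fun _ _ => 0 : C))
  (fun S : fmx C J J => psdf S /\ mulf S S = A)).
have [s [v [s0 ov AE]]] := psdf_spectral psdA.
pose S : fmx C J J := fun i j => \sum_k sqrtC (s k) * (v k i * (v k j)^*).
exists S; split; first by apply: psdf_of_spectral => k; rewrite sqrtC_ge0.
apply: functional_extensionality => i; apply: functional_extensionality => j.
rewrite (mulf_spectral ov (fun _ _ => erefl) (fun _ _ => erefl)) AE.
by apply: eq_bigr => k _; rewrite -expr2 sqrtCK.
Qed.

(* Polar decomposition, in the form of the variational formula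
   [trnorm G = tr (W G)] with [W] the partial isometry sending [u k] to [v k]. *)
Lemma trnorm_dual (I J : finType) (G : fmx C I J) :
  exists (K : finType) (u : K -> I -> C) (v : K -> J -> C),
    [/\ orthonormalf u, orthonormalf v, 0 <= trnorm G &
        trnorm G = \sum_k dotf (u k) (apply_mx G (v k))].
Proof.
have [psdS SS] := psd_sqrtP (psdf_gram G).
have [s [v [s0 ov SE]]] := psdf_spectral psdS.
have trS : trnorm G = \sum_k s k by exact: trf_spectral ov SE.
(* The images under [G] of the eigenvectors of the root are orthogonal, of norm [s k]: the Gram
   matrix of [G] is the square of the root. *)
have dGv k l : dotf (apply_mx G (v k)) (apply_mx G (v l)) =
    s l ^+ 2 * (k == l)%:R.
  rewrite dotf_gram -SS.
  transitivity (dotf (v k) (fun i => \sum_m (s m ^+ 2 * (m == l)%:R) * v m i)).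
    apply: eq_bigr => i _; rewrite mulr_sumr.
    under eq_bigr => j _ do rewrite (mulf_spectral ov SE SE) mulr_sumr mulr_suml.
    rewrite exchange_big; apply: eq_bigr => m _ /=.
    rewrite -(ov m l) /dotf mulr_sumr mulr_suml mulr_sumr.
    by apply: eq_bigr => j _; ring.
  rewrite dotf_orthonormal //.
  by have [->|] := eqVneq k l; rewrite ?mulr0.
(* Only nonzero singular values permit normalizing the images; the zero ones add nothing to the
   trace. *)
pose K : finType := {k | s k != 0}.
pose u (k : K) i := (s (val k))^-1 * apply_mx G (v (val k)) i.
have du (k : K) w : dotf (u k) w = (s (val k))^-1 * dotf (apply_mx G (v (val k))) w.
  rewrite /dotf mulr_sumr; apply: eq_bigr => i _.
  by rewrite rmorphM /= fmorphV /= geC0_conj // mulrA.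
exists K, u, (fun k => v (val k)); split.
- move=> k l; rewrite du.
  have -> : dotf (apply_mx G (v (val k))) (u l) =
      (s (val l))^-1 * dotf (apply_mx G (v (val k))) (apply_mx G (v (val l))).
    by rewrite mulr_sumr; apply: eq_bigr => i _; rewrite mulrCA.
  rewrite dGv (inj_eq val_inj); case: eqVneq => [->|_]; last by rewrite !mulr0.
  by rewrite mulr1 expr2 mulKf ?mulVf // (valP l).
- by move=> k l; rewrite ov (inj_eq val_inj).
- by rewrite trS sumr_ge0.
rewrite trS (bigID (fun k => s k != 0)) /= [X in _ + X]big1 ?addr0; last first.
  by move=> k; rewrite negbK => /eqP.
rewrite (big_sub [pred k | s k != 0]) /=; apply: eq_bigr => k _.
by rewrite du dGv eqxx mulr1 expr2 mulKf //; exact: (valP k).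
Qed.

(** In the dual pairing each rank-one term is a sum of products of Fourier coefficients of [a m] and
    [b m], which Cauchy-Schwarz and Bessel bound; the weights sum to one. *)
Lemma trnorm_convex_le (I J L : finType) (G : fmx C I J) (p : L -> C)
    (a : L -> I -> C) (b : L -> J -> C) (A B : C) :
  (forall m, 0 <= p m) -> \sum_m p m = 1 ->
  (forall i j, G i j = \sum_m p m * (a m i * b m j)) ->
  (forall m, \sum_i `|a m i| ^+ 2 <= A) ->
  (forall m, \sum_j `|b m j| ^+ 2 <= B) ->
  trnorm G <= sqrtC (A * B).
Proof.
move=> p0 p1 GE leA leB.
have [K [u [v [ou ov tr0 trE]]]] := trnorm_dual G.
(* [b] enters [G] without conjugation, so its pairing with [v k] is the conjugate of an inner
   product with the conjugate of [b]. *)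
have {}trE : trnorm G =
    \sum_m p m * \sum_k dotf (u k) (a m) * (dotf (v k) (fun j => (b m j)^*))^*.
  rewrite trE; under [RHS]eq_bigr do rewrite mulr_sumr.
  rewrite [RHS]exchange_big; apply: eq_bigr => k _ /=.
  transitivity (dotf (u k)
      (fun i => \sum_m (p m * dotf (fun j => (b m j)^*) (v k)) * a m i)).
    apply: eq_bigr => i _; congr (_ * _); rewrite /apply_mx.
    under eq_bigr => j _ do rewrite GE mulr_suml.
    rewrite exchange_big /=; apply: eq_bigr => m _.
    rewrite /dotf mulr_sumr mulr_suml; apply: eq_bigr => j _.
    by rewrite conjCK; ring.
  rewrite dotf_sumr; apply: eq_bigr => m _.
  by rewrite dotf_conj; ring.
apply: le_trans (_ : \sum_m p m * sqrtC (A * B) <= _); last first.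
  by rewrite -mulr_suml p1 mul1r.
rewrite -(ger0_norm tr0) trE.
apply: le_trans (ler_norm_sum _ _ _) _; apply: ler_sum => m _.
rewrite normrM ger0_norm // ler_wpM2l //.
apply: le_trans (ler_norm_sum _ _ _) _.
under eq_bigr => k _ do rewrite normrM norm_conjC.
apply: cauchy_schwarz_sum; first exact: le_trans (bessel _ ou) (leA m).
apply: le_trans (bessel _ ov) _.
by under eq_bigr do rewrite norm_conjC; exact: leB.
Qed.

End TraceNorm.

(** * Local probability bound *)

Section LocalBound.
Variable C : numClosedFieldType.

(** The eigenvalues are nonnegative with sum one, hence at most one, and each square is at most the
    eigenvalue itself. *)
Lemma purity_le1 (I : finType) (rho : fmx C I I) :
  densityf rho -> trf (mulf rho rho) <= 1.
Proof.
move=> [psd_rho tr1]; have [s [v [s0 ov rhoE]]] := psdf_spectral psd_rho.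
rewrite (trf_spectral ov (mulf_spectral ov rhoE rhoE)).
have s1 : \sum_k s k = 1 by rewrite -(trf_spectral ov rhoE).
rewrite -[leRHS]s1; apply: ler_sum => k _; rewrite ler_piMl // -s1 (bigD1 k) //=.
by rewrite lerDl sumr_ge0.
Qed.

(** For hermitian [A] this trace is the squared Hilbert-Schmidt norm. *)
Lemma trf_mulf_hermitian_ge0 (I : finType) (A : fmx C I I) :
  hermitianf A -> 0 <= trf (mulf A A).
Proof.
move=> hA; apply: sumr_ge0 => i _; apply: sumr_ge0 => j _.
by rewrite (hA i j) mul_conjC_ge0.
Qed.

Lemma trf_mulf_conj (I : finType) (A B : fmx C I I) :
  hermitianf A -> hermitianf B -> (trf (mulf A B))^* = trf (mulf A B).
Proof.
move=> hA hB; rewrite /trf /mulf rmorph_sum [RHS]exchange_big.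
rewrite /= exchange_big [RHS]exchange_big; apply: eq_bigr => i _.
rewrite rmorph_sum; apply: eq_bigr => j _.
by rewrite rmorphM /= -hA -hB.
Qed.

Definition to_mx (d : nat) (A : fmx C 'I_d 'I_d) : 'M[C]_d := \matrix_(i, j) A i j.

Lemma mxtrace_mul_to_mx (d : nat) (A B : fmx C 'I_d 'I_d) :
  \tr (to_mx A *m to_mx B) = trf (mulf A B).
Proof.
by apply: eq_bigr => i _; rewrite mxE; apply: eq_bigr => j _; rewrite !mxE.
Qed.

Lemma mxtrace_to_mx (d : nat) (A : fmx C 'I_d 'I_d) : \tr (to_mx A) = trf A.
Proof. by apply: eq_bigr => i _; rewrite mxE. Qed.

Lemma mxtrace_sqrB (d : nat) (A B : 'M[C]_d) (c : C) :
  \tr ((A - c *: B) *m (A - c *: B)) =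
  \tr (A *m A) - c * \tr (B *m A) - (c * \tr (B *m A) - c * (c * \tr (B *m B))).
Proof.
rewrite mulmxBl !mulmxBr !raddfB /= -!scalemxAl -!scalemxAr !mxtraceZ.
by rewrite [\tr (A *m B)]mxtrace_mulC; ring.
Qed.

(** [Y / lam] is the orthogonal projection of the traceless part [z0] of the state to the span of
    the effects. Its squared norm [S / lam] is thus at most that of [z0], which purity bounds by
    [1 - 1/d]; the mean probabilities [1/M] add [N / M]. *)
Lemma povm_prob_sqr_le (d N M : nat) (x : C)
    (E : 'I_N -> 'I_M -> fmx C 'I_d 'I_d) (rho : fmx C 'I_d 'I_d) :
  ic_povm x E -> densityf rho ->
  \sum_a \sum_k `|trf (mulf (E a k) rho)| ^+ 2 <= Kconst d M x.
Proof.
case=> [[M2 NM] xR [x_gt x_le1 x_le2] [psdE sumE] [trE trE2 trEl trEb]] rho_d.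
have [[h_rho _] tr_rho] := rho_d.
(* For [d = 0] the bounds on [x] would read [0 < x <= 0]. *)
have d_gt0 : (0 < d)%N.
  by case: d E rho x_gt x_le2 {NM x_le1 psdE sumE trE trE2 trEl trEb rho_d h_rho tr_rho}
    => // E rho; rewrite !mul0r => /lt_le_trans h /h; rewrite ltxx.
have d0 : d%:R != 0 :> C by rewrite pnatr_eq0 -lt0n.
have M0 : M%:R != 0 :> C by rewrite pnatr_eq0 -lt0n (ltn_trans _ M2).
have M1_gt0 : 0 < M%:R - 1 :> C by rewrite subr_gt0 ltr1n.
have M1 : M%:R - 1 != 0 :> C by rewrite gt_eqF.
pose z := to_mx rho; pose e a k := to_mx (E a k).
(* Here [1/M] is the probability of each outcome in the maximally mixed state. *)
pose f a k := trf (mulf (E a k) rho) - M%:R^-1.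
have fR a k : (f a k)^* = f a k.
  rewrite rmorphB /= trf_mulf_conj //; last by case: (psdE a k).
  by rewrite fmorphV /= conjC_nat.
have sum_e a : \sum_k e a k = 1%:M.
  apply/matrixP => i j; rewrite summxE mxE; rewrite -[RHS](sumE a i j); apply: eq_bigr => k _.
  by rewrite mxE.
have tr_z : \tr z = 1 by rewrite mxtrace_to_mx.
have sum_f a : \sum_k f a k = 0.
  rewrite sumrB; under eq_bigr do rewrite -mxtrace_mul_to_mx.
  rewrite -(raddf_sum (@mxtrace _ _)) -mulmx_suml sum_e mul1mx -/z /= tr_z.
  by rewrite sumr_const card_ord -[_ *+ M]mulr_natl mulfV ?subrr.
(* [w] is the overlap of two distinct effects of one POVM; the gap [lam] is positive exactly because
   [x > d / M^2]. *)
pose w := (d%:R - M%:R * x) / (M%:R * (M%:R - 1)).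
pose lam := x - w.
have lamE : lam = (M%:R ^+ 2 * x - d%:R) / (M%:R * (M%:R - 1)).
  by rewrite /lam /w; field; rewrite M0 M1.
have lam_gt0 : 0 < lam.
  rewrite lamE divr_gt0 // ?mulr_gt0 ?ltr0n ?(ltn_trans _ M2) //.
  rewrite subr_gt0 mulrC -ltr_pdivrMr // exprn_gt0 // ltr0n.
  exact: ltn_trans M2.
pose S := \sum_a \sum_k f a k ^+ 2.
pose Y := \sum_a \sum_k f a k *: e a k.
pose z0 := z - d%:R^-1%:M.
(* In the POVM [a] the sum is [x * f a k] plus [w] times the other [f a l], which add up to
   [- f a k]. Any other POVM has constant overlap with [e a k], and its [f b l] sum to zero. *)
have tr_eY a k : \tr (e a k *m Y) = lam * f a k.
  rewrite /Y mulmx_sumr raddf_sum (bigD1 a) //= [X in _ + X]big1 ?addr0.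
    rewrite mulmx_sumr raddf_sum /=.
    under eq_bigr => l _ do rewrite -scalemxAr mxtraceZ mxtrace_mul_to_mx.
    have := sum_f a; rewrite (bigD1 k) //= => /eqP; rewrite addr_eq0 => /eqP fk.
    rewrite (bigD1 k) //= trE2.
    rewrite (eq_bigr (fun l => f a l * w)); last first.
      by move=> l lk; rewrite trEl // eq_sym.
    by rewrite -mulr_suml -[\sum_(i | _) _]opprK -fk /lam; ring.
  move=> b ba; rewrite mulmx_sumr raddf_sum /=.
  under eq_bigr => l _ do
    rewrite -scalemxAr mxtraceZ mxtrace_mul_to_mx trEb 1?eq_sym //.
  by rewrite -mulr_suml sum_f mul0r.
have tr_Y (V : 'M[C]_d) : \tr (Y *m V) = \sum_a \sum_k f a k * \tr (e a k *m V).
  rewrite mulmx_suml raddf_sum; apply: eq_bigr => a _.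
  rewrite mulmx_suml raddf_sum; apply: eq_bigr => k _.
  by rewrite /= -scalemxAl mxtraceZ.
have tr_YY : \tr (Y *m Y) = lam * S.
  rewrite tr_Y mulr_sumr; apply: eq_bigr => a _; rewrite mulr_sumr.
  by apply: eq_bigr => k _; rewrite tr_eY; ring.
have tr_Yz0 : \tr (Y *m z0) = S.
  rewrite tr_Y; apply: eq_bigr => a _; apply: eq_bigr => k _.
  rewrite mulmxBr raddfB /= mul_mx_scalar mxtraceZ mxtrace_mul_to_mx.
  rewrite mxtrace_to_mx trE expr2; congr (_ * (_ - _)).
  by rewrite mulrA mulVf // mul1r.
have tr_z0z0 : \tr (z0 *m z0) = trf (mulf rho rho) - d%:R^-1.
  rewrite mulmxBr raddfB /= mul_mx_scalar mxtraceZ raddfB /= tr_z.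
  rewrite mxtrace_scalar mulmxBl raddfB /= mul_scalar_mx mxtraceZ tr_z.
  rewrite mxtrace_mul_to_mx -[d%:R^-1 *+ d]mulr_natl mulfV //; ring.
(* Positivity of [tr ((z0 - Y / lam)^2)]. *)
have S_le : S <= lam * (1 - d%:R^-1).
  pose X := z0 - lam^-1 *: Y.
  have : 0 <= trf (mulf (fun i j => X i j) (fun i j => X i j)).
    apply: trf_mulf_hermitian_ge0 => i j.
    rewrite /X !mxE !summxE rmorphB rmorphB /= -h_rho; congr (_ - _ - _).
      by rewrite rmorphMn fmorphV /= conjC_nat eq_sym.
    rewrite rmorphM fmorphV /= geC0_conj 1?ltW //; congr (_ * _).
    rewrite rmorph_sum; apply: eq_bigr => a _; rewrite !summxE rmorph_sum.
    apply: eq_bigr => k _; rewrite !mxE rmorphM /= fR.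
    by case: (psdE a k) => hE _; rewrite hE.
  rewrite -mxtrace_mul_to_mx (_ : to_mx _ = X); last first.
    by apply/matrixP => i j; rewrite mxE.
  rewrite mxtrace_sqrB tr_Yz0 tr_YY tr_z0z0.
  have -> : trf (mulf rho rho) - d%:R^-1 - lam^-1 * S
      - (lam^-1 * S - lam^-1 * (lam^-1 * (lam * S)))
      = trf (mulf rho rho) - d%:R^-1 - lam^-1 * S.
    have lam0 : lam != 0 by rewrite gt_eqF.
    rewrite mulKf // subrr subr0 //.
  rewrite subr_ge0 mulrC ler_pdivrMr // mulrC => /le_trans; apply.
  by rewrite ler_pM2l // lerD2r purity_le1.
have NE : N%:R * (M%:R - 1) = d%:R ^+ 2 - 1 :> C.
  have := congr1 (fun m => m%:R : C) NM.
  by rewrite /= natrM !natrB ?natrX ?expn_gt0 ?d_gt0 // (leq_trans _ M2).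
have -> : \sum_a \sum_k `|trf (mulf (E a k) rho)| ^+ 2 = S + N%:R / M%:R.
  have -> : N%:R / M%:R = \sum_(a < N) (M%:R^-1 : C).
    by rewrite sumr_const card_ord mulr_natl.
  rewrite -big_split; apply: eq_bigr => a _ /=.
  (* The cross term vanishes on summing over [k], and the constants of one POVM add up to [1/M]. *)
  transitivity (\sum_k (f a k ^+ 2 + 2 * M%:R^-1 * f a k + M%:R^-2)).
    apply: eq_bigr => k _; rewrite real_normK; last first.
      by apply/CrealP; rewrite trf_mulf_conj //; case: (psdE a k).
    by rewrite /f; field; rewrite M0.
  rewrite !big_split /= -mulr_sumr sum_f mulr0 addr0 sumr_const card_ord.
  by congr (_ + _); rewrite -[_ *+ M]mulr_natl; field; rewrite M0.
apply: le_trans (_ : lam * (1 - d%:R^-1) + N%:R / M%:R <= _).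
  by rewrite lerD2r.
(* Informational completeness eliminates [N]; the bound then equals [Kconst]. *)
have -> : N%:R = (d%:R ^+ 2 - 1) / (M%:R - 1) :> C by rewrite -NE mulfK.
rewrite /Kconst lamE le_eqVlt; apply/orP; left; apply/eqP.
by field; rewrite d0 M0 M1.
Qed.

End LocalBound.

(** * Product states *)

Section ProductStates.
Variable C : numClosedFieldType.

Lemma sum_delta_l (I : finType) (a : I) (F : I -> C) :
  \sum_i (i == a)%:R * F i = F a.
Proof.
rewrite (bigD1 a) //= eqxx mul1r big1 ?addr0 // => i ia.
by rewrite (negPf ia) mul0r.
Qed.

Lemma trf_tensf (I : finType) (D : I -> finType)
    (A : forall i, fmx C (D i) (D i)) : trf (tensf A) = \prod_i trf (A i).
Proof. by rewrite (prod_sum_dffun (fun i t => A i t t)). Qed.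

Lemma mulf_tensf (I : finType) (D : I -> finType)
    (A B : forall i, fmx C (D i) (D i)) x y :
  mulf (tensf A) (tensf B) x y = tensf (fun i => mulf (A i) (B i)) x y.
Proof.
rewrite /tensf (prod_sum_dffun (fun i t => A i (x i) t * B i t (y i))).
by apply: eq_bigr => z _; rewrite big_split.
Qed.

Lemma trf_mulf_tensf (I : finType) (D : I -> finType)
    (A B : forall i, fmx C (D i) (D i)) :
  trf (mulf (tensf A) (tensf B)) = \prod_i trf (mulf (A i) (B i)).
Proof. by rewrite -trf_tensf; apply: eq_bigr => x _; exact: mulf_tensf. Qed.

Lemma trf_mulf_sumr (I L : finType) (A : fmx C I I) (p : L -> C)
    (B : L -> fmx C I I) :
  trf (mulf A (fun i j => \sum_m p m * B m i j)) =
  \sum_m p m * trf (mulf A (B m)).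
Proof.
rewrite /trf /mulf.
under eq_bigr => i _ do (under eq_bigr => j _ do rewrite mulr_sumr;
  rewrite exchange_big /=).
rewrite exchange_big; apply: eq_bigr => m _; rewrite mulr_sumr.
apply: eq_bigr => i _; rewrite mulr_sumr; apply: eq_bigr => j _.
by rewrite mulrCA.
Qed.

Variables (n : nat) (d : 'I_n -> nat) (q : 'I_n).

Definition tens_others (A : forall i, fmx C 'I_(d i) 'I_(d i)) :
    fmx C (cidx d q) (cidx d q) :=
  tensf (fun j : others q => A (val j)).

Lemma tensf_split (A : forall i, fmx C 'I_(d i) 'I_(d i)) (x y : gidx d) :
  tensf A x y = A q (x q) (y q) * tens_others A (restr q x) (restr q y).
Proof.
rewrite /tensf (bigD1 q) //=; congr (_ * _).
rewrite -(big_others q _ (fun i => A i (x i) (y i))).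
by apply: eq_bigr => j _; rewrite !ffunE.
Qed.

Lemma sum_split2 (F : 'I_(d q) -> cidx d q -> 'I_(d q) -> cidx d q -> C) :
  \sum_(x : gidx d) \sum_(y : gidx d) F (x q) (restr q x) (y q) (restr q y) =
  \sum_a \sum_u \sum_b \sum_v F a u b v.
Proof.
rewrite -(sum_split (fun a u => \sum_b \sum_v F a u b v)).
by apply: eq_bigr => x _; exact: sum_split.
Qed.

Lemma red_q_tensf (A : forall i, fmx C 'I_(d i) 'I_(d i)) (a b : 'I_(d q)) :
  red_q (tensf A) a b = A q a b * \prod_(j : others q) trf (A (val j)).
Proof.
rewrite /red_q -(trf_tensf (fun j : others q => A (val j))) -/(tens_others A).
(* One Kronecker delta per index, nested so that the sums collapse one at a time. *)
transitivity (\sum_a' (a' == a)%:R * \sum_b' (b' == b)%:R *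
    (\sum_u \sum_v (v == u)%:R * (A q a' b' * tens_others A u v))).
  under eq_bigr => x _ do under eq_bigr => y _ do rewrite tensf_split.
  rewrite (sum_split2 (fun a' u b' v => ((a' == a) && (b' == b) && (u == v))%:R *
    (A q a' b' * tens_others A u v))).
  apply: eq_bigr => a' _; rewrite exchange_big mulr_sumr.
  apply: eq_bigr => b' _; rewrite /= mulr_sumr mulr_sumr; apply: eq_bigr => u _.
  rewrite mulr_sumr mulr_sumr; apply: eq_bigr => v _.
  by rewrite -!mulnb !natrM -!mulrA [v == u]eq_sym.
rewrite sum_delta_l sum_delta_l mulr_sumr; apply: eq_bigr => u _.
by rewrite sum_delta_l.
Qed.

Lemma red_bar_tensf (A : forall i, fmx C 'I_(d i) 'I_(d i)) (u v : cidx d q) :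
  red_bar (tensf A) u v = trf (A q) * tens_others A u v.
Proof.
rewrite /red_bar.
transitivity (\sum_u' (u' == u)%:R * \sum_v' (v' == v)%:R *
    (\sum_a \sum_b (b == a)%:R * (A q a b * tens_others A u' v'))).
  under eq_bigr => x _ do under eq_bigr => y _ do rewrite tensf_split.
  rewrite (sum_split2 (fun a u' b v' => ((u' == u) && (v' == v) && (a == b))%:R *
    (A q a b * tens_others A u' v'))).
  rewrite exchange_big; apply: eq_bigr => u' _ /=.
  under eq_bigr => a _ do rewrite exchange_big /=.
  rewrite exchange_big mulr_sumr.
  apply: eq_bigr => v' _; rewrite /= mulr_sumr mulr_sumr; apply: eq_bigr => a _.
  rewrite mulr_sumr mulr_sumr; apply: eq_bigr => b _.
  by rewrite -!mulnb !natrM -!mulrA [b == a]eq_sym.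
rewrite sum_delta_l sum_delta_l mulr_suml; apply: eq_bigr => a _.
by rewrite sum_delta_l.
Qed.

(** * Linearity in the state, and factorization of correlations *)

Variables (L : finType) (p : L -> C).
Variable f : L -> fmx C (gidx d) (gidx d).

Lemma red_q_sum (a b : 'I_(d q)) :
  red_q (fun x y => \sum_m p m * f m x y) a b = \sum_m p m * red_q (f m) a b.
Proof.
rewrite /red_q.
under eq_bigr => x _ do (under eq_bigr => y _ do rewrite mulr_sumr;
  rewrite exchange_big /=).
rewrite exchange_big; apply: eq_bigr => m _; rewrite mulr_sumr.
apply: eq_bigr => x _; rewrite mulr_sumr; apply: eq_bigr => y _.
by rewrite mulrCA.
Qed.

Lemma red_bar_sum (u v : cidx d q) :
  red_bar (fun x y => \sum_m p m * f m x y) u v =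
  \sum_m p m * red_bar (f m) u v.
Proof.
rewrite /red_bar.
under eq_bigr => x _ do (under eq_bigr => y _ do rewrite mulr_sumr;
  rewrite exchange_big /=).
rewrite exchange_big; apply: eq_bigr => m _; rewrite mulr_sumr.
apply: eq_bigr => x _; rewrite mulr_sumr; apply: eq_bigr => y _.
by rewrite mulrCA.
Qed.

Variables (N M : 'I_n -> nat).
Variable E : forall i : 'I_n, 'I_(N i) -> 'I_(M i) -> fmx C 'I_(d i) 'I_(d i).

Lemma Pmat_sum r c :
  Pmat E (fun x y => \sum_m p m * f m x y) r c =
  \sum_m p m * Pmat E (q := q) (f m) r c.
Proof.
rewrite /Pmat.
under eq_bigr => x _ do (under eq_bigr => y _ do rewrite mulr_sumr;
  rewrite exchange_big /=).
rewrite exchange_big; apply: eq_bigr => m _; rewrite mulr_sumr.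
apply: eq_bigr => x _; rewrite mulr_sumr; apply: eq_bigr => y _.
by rewrite mulrCA.
Qed.

(** Joint outcome probabilities factor on a product state, so it contributes a block of rank at most
    one. *)
Lemma Pmat_tensf (A : forall i, fmx C 'I_(d i) 'I_(d i)) r c :
  Pmat E (q := q) (tensf A) r c =
  trf (mulf (E r.1 r.2) (A q)) *
  \prod_(j : others q) trf (mulf (E (c j).1 (c j).2) (A (val j))).
Proof.
rewrite /Pmat -trf_mulf_tensf -/(Ebar E c) -/(tens_others A).
under eq_bigr => x _ do under eq_bigr => y _ do rewrite tensf_split.
rewrite (sum_split2 (fun a u b v => E r.1 r.2 a b * Ebar E c u v *
  (A q b a * tens_others A v u))).
rewrite /trf mulr_suml; apply: eq_bigr => a _; rewrite mulr_sumr.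
apply: eq_bigr => u _; rewrite /mulf mulr_suml; apply: eq_bigr => b _.
rewrite mulr_sumr; apply: eq_bigr => v _.
by rewrite mulrACA.
Qed.

End ProductStates.

(** * The trace norm bound for fully separable states *)

Theorem theorem3 (C : numClosedFieldType) (n : nat) (d N M : 'I_n -> nat)
    (x : 'I_n -> C)
    (E : forall i : 'I_n, 'I_(N i) -> 'I_(M i) -> fmx C 'I_(d i) 'I_(d i))
    (rho : fmx C (gidx d) (gidx d)) (mu nu : C) (l : nat) :
  densityf rho ->
  (forall i, ic_povm (x i) (E i)) ->
  mu \is Num.real -> nu \is Num.real -> (0 < l)%N ->
  fully_separable rho ->
  forall q : 'I_n,
    trnorm (Mmat E q rho l mu nu) <=
    sqrtC ((l%:R * mu ^+ 2 + Kconst (d q) (M q) (x q)) *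
           (l%:R * nu ^+ 2 + \prod_(i < n | i != q) Kconst (d i) (M i) (x i))).
Proof.
move=> _ povmE muR nuR _ [L [p [sg [p0 p1 sg_dens rhoE]]]] q.
have -> : rho = fun y z => \sum_m p m * tensf (sg m) y z.
  by do 2![apply: functional_extensionality => ?]; exact: rhoE.
pose pr m i (r : 'I_(N i) * 'I_(M i)) := trf (mulf (E i r.1 r.2) (sg m i)).
pose prb m (c : colidx N M q) := \prod_(j : others q) pr m (val j) (c j).
have trsg m i : trf (sg m i) = 1 by case: (sg_dens m i).
have tauE r : tau_vec E (fun y z => \sum_m p m * tensf (sg m) y z) r =
    \sum_m p m * pr m q r.
  rewrite /tau_vec -trf_mulf_sumr; congr (trf (mulf _ _)).
  apply: functional_extensionality => a; apply: functional_extensionality => b.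
  rewrite red_q_sum; apply: eq_bigr => m _.
  by rewrite red_q_tensf big1 ?mulr1 // => j _; rewrite trsg.
have sigmaE c : sigma_vec E (fun y z => \sum_m p m * tensf (sg m) y z) c =
    \sum_m p m * prb m c.
  transitivity (\sum_m p m * trf (mulf (Ebar E c) (tens_others (q := q) (sg m)))).
    rewrite /sigma_vec -trf_mulf_sumr; congr (trf (mulf _ _)).
    apply: functional_extensionality => u; apply: functional_extensionality => v.
    rewrite red_bar_sum; apply: eq_bigr => m _.
    by rewrite red_bar_tensf trsg mul1r.
  by apply: eq_bigr => m _; rewrite trf_mulf_tensf.
have PE r c : Pmat E (fun y z => \sum_m p m * tensf (sg m) y z) r c =
    \sum_m p m * (pr m q r * prb m c).
  by rewrite Pmat_sum; apply: eq_bigr => m _; rewrite Pmat_tensf.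
have pr_le m i : \sum_r `|pr m i r| ^+ 2 <= Kconst (d i) (M i) (x i).
  rewrite -(pair_bigA _ (fun a k => `|pr m i (a, k)| ^+ 2)) /=.
  exact: povm_prob_sqr_le (povmE i) (sg_dens m i).
(* The outer product of [A m] and [B m] reproduces all four blocks; the weights summing to one
   account for the constant block [mu * nu]. *)
pose A m (r : 'I_l + rowidx N M q) := if r is inr r' then pr m q r' else mu.
pose B m (c : 'I_l + colidx N M q) := if c is inr c' then prb m c' else nu.
apply: (@trnorm_convex_le _ _ _ _ _ p A B) => //.
- move=> [r|r] [c|c] /=.
  + by rewrite -mulr_suml p1 mul1r.
  + by rewrite sigmaE mulr_sumr; apply: eq_bigr => m _; rewrite mulrCA.
  + rewrite tauE mulr_sumr; apply: eq_bigr => m _.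
    by rewrite mulrCA [nu * _]mulrC.
  + exact: PE.
- move=> m; rewrite big_sumType /= sumr_const card_ord real_normK //.
  by rewrite mulr_natl lerD2l; exact: pr_le.
move=> m; rewrite big_sumType /= sumr_const card_ord real_normK //.
rewrite mulr_natl lerD2l.
rewrite -(big_others q _ (fun i => Kconst (d i) (M i) (x i))).
(* The square sum of product probabilities over all tuples factors into local square sums, each
   bounded by its own constant. *)
apply: le_trans (_ : \prod_(j : others q) \sum_r `|pr m (val j) r| ^+ 2 <= _).
  rewrite prod_sum_dffun; apply: ler_sum => c _.
  by rewrite normr_prod -prodrXl.
apply: ler_prod => j _; rewrite pr_le andbT.
by apply: sumr_ge0 => r _; rewrite exprn_ge0.
Qed.
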